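(* Let $d$ be an integer. Let $\mathcal{S}=\{S_k\le \mathrm{Sym}(m_k)\}_{k\in\mathbb{N}}$ be a sequence of finite transitive permutation groups such that each $S_k$ is perfect and at most $d$-generated as an abstract group. Suppose that for every $k\in\mathbb{N}$ there exist elements $i,j\in\{1,\ldots,m_k\}$ such that $\mathrm{St}_{S_k}(i)\neq \mathrm{St}_{S_k}(j)$. Let $G=\varprojlim G_n$ be an infinitely iterated mixed wreath product of type $(\mathcal{S},\{k_n\}_{n\in\mathbb{N}})$ of stride at most $m$. Then $G$ is topologically finitely generated. In particular the profinite group $G$ is topologically generated by at most $2md$ elements.
   Context: Here $\mathbb{N}=\{1,2,3,\ldots\}$, actions are right actions, $\mathrm{Sym}(m)$ is the symmetric group on $\{1,\ldots,m\}$, and $\mathrm{St}_G(i)$ is the stabiliser of the point $i$ in $G$. For permutation groups $A\le \mathrm{Sym}(m)$ and $B\le\mathrm{Sym}(n)$, the abstract wreath product is $A^n\rtimes B$, where $B$ permutes the $n$ coordinates of $A^n$ (the entry in position $t$ is moved by $b\in B$ to position $t^b$). It is made into a permutation group in two ways: (1) the exponentiation of $A$ by $B$ acts on $\{1,\ldots,m\}^n$ with the product action: $(a_1,\ldots,a_n)\in A^n$ acts by $(i_1,\ldots,i_n)\mapsto (i_1^{a_1},\ldots,i_n^{a_n})$ and $b\in B$ permutes coordinates, moving the entry in position $t$ to position $t^b$; (2) the permutational wreath product of $A$ by $B$ acts on $\{1,\ldots,m\}\times\{1,\ldots,n\}$ by $(i,t)^{(a_1,\ldots,a_n)b}=(i^{a_t},t^b)$.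 Mixed wreath products: let $\{k_n\}_{n\in\mathbb{N}}$ be an increasing sequence of positive integers. Define permutation groups $G_k$ by $G_1=S_1$ and, for $k\ge 2$: if $k\in\{k_n\}_{n\in\mathbb{N}}$, then $G_k$ is the exponentiation of $S_k$ by $G_{k-1}$; if $k\notin\{k_n\}_{n\in\mathbb{N}}$, then $G_k$ is the permutational wreath product of $S_k$ by $G_{k-1}$. These are the iterated mixed wreath products of type $(\mathcal{S},\{k_n\}_{n\in\mathbb{N}})$. For an integer $m$, they have stride at most $m$ if $k_{n+1}-k_n\le m$ for every $n\in\mathbb{N}$. The groups $G_n$ with the natural projections $G_n\to G_{n-1}$ form an inverse system of finite groups; the profinite group $\varprojlim G_n$ is the infinitely iterated mixed wreath product of type $(\mathcal{S},\{k_n\}_{n\in\mathbb{N}})$, and it has stride at most $m$ if the groups $G_n$ do. *)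

(* Defs.v *)
From HB Require Import structures.
From mathcomp Require Import all_boot all_order all_algebra all_fingroup all_solvable.

Set Implicit Arguments.
Unset Strict Implicit.
Unset Printing Implicit Defensive.

Local Open Scope group_scope.

(** The abstract group and the action are kept separate, as a wreath product is
    one abstract group with two actions; the action is faithful in all the
    cases of interest (the sets acted on have at least two points). *)
Record permGroup := PermGroup {
  pts : finType;
  grp : finGroupType;
  pact : {action grp &-> pts}
}.

Section PermGroupOf.
Variables (m : nat) (A : {group {perm 'I_m}}).

Definition subg_perm (i : 'I_m) (a : subg_of A) : 'I_m := sgval a i.

Lemma subg_perm1 : subg_perm^~ 1 =1 id.
Proof. by move=> i; rewrite /subg_perm /= perm1. Qed.

Lemma subg_permM i : act_morph subg_perm i.
Proof. by move=> a b; rewrite /subg_perm sgvalM // permM. Qed.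

Definition permGroup_of : permGroup :=
  PermGroup (TotalAction subg_perm1 subg_permM).
End PermGroupOf.

Section Wreath.
Variables A B : permGroup.

Definition base_group : finGroupType := {dffun forall t : pts B, grp A}.

(** [b] moves the entry in position [t] to position [t ^ b]. *)
Definition base_perm (a : base_group) (b : grp B) : base_group :=
  [ffun t => a (pact B t b^-1)].

Lemma base_perm1 : base_perm^~ 1 =1 id.
Proof. by move=> a; apply/ffunP=> t; rewrite ffunE invg1 act1. Qed.

Lemma base_permM a : act_morph base_perm a.
Proof. by move=> b c; apply/ffunP=> t; rewrite !ffunE invMg actM. Qed.

Definition base_action := TotalAction base_perm1 base_permM.

Lemma base_is_groupAction : is_groupAction [set: base_group] base_action.
Proof.
move=> b _; rewrite inE; apply/andP; split; first by apply/subsetP=> x; rewrite inE.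
apply/morphicP=> x y _ _; rewrite !actpermE /=.
by apply/ffunP=> t; rewrite !ffunE.
Qed.

Definition base_groupAction := GroupAction base_is_groupAction.

(** An element of [sdprod_by] is a pair [(b, a)] standing for the product of [b]
    followed by [a]; hence the formulas for the two actions below, in which the
    coordinates are first permuted by [b]. *)
Definition wreath : finGroupType := sdprod_by base_groupAction.

Definition wreath_top (g : wreath) : grp B := (pair_of_sd g).1.

Lemma wreath_topM : {in [set: wreath] &, {morph wreath_top : g h / g * h}}.
Proof. by []. Qed.

Definition wreath_proj : {morphism [set: wreath] >-> grp B} :=
  Morphism wreath_topM.

Definition exp_fun (i : {ffun pts B -> pts A}) (g : wreath) :
    {ffun pts B -> pts A} :=
  let: (b, a) := pair_of_sd g in
  [ffun t => pact A (i (pact B t b^-1)) (a t)].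

Lemma exp_fun1 : exp_fun^~ 1 =1 id.
Proof.
by move=> i; apply/ffunP=> t; rewrite /exp_fun /= !ffunE invg1 !act1.
Qed.

Lemma exp_funM i : act_morph exp_fun i.
Proof.
case=> -[b a] p [[c e] q]; apply/ffunP=> t.
by rewrite /exp_fun /= !ffunE invMg !actM.
Qed.

Definition exponentiation : permGroup :=
  PermGroup (TotalAction exp_fun1 exp_funM).

Definition pwr_fun (it : pts A * pts B) (g : wreath) : pts A * pts B :=
  let: (b, a) := pair_of_sd g in
  (pact A it.1 (a (pact B it.2 b)), pact B it.2 b).

Lemma pwr_fun1 : pwr_fun^~ 1 =1 id.
Proof. by move=> [i t]; rewrite /pwr_fun /= !ffunE !act1. Qed.

Lemma pwr_funM it : act_morph pwr_fun it.
Proof.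
case=> -[b a] p [[c e] q]; case: it => i t.
by rewrite /pwr_fun /= !ffunE !actM actK.
Qed.

Definition permutational_wreath : permGroup :=
  PermGroup (TotalAction pwr_fun1 pwr_funM).
End Wreath.

Definition mixed_step (e : bool) (A B : permGroup) : permGroup :=
  if e then exponentiation A B else permutational_wreath A B.

Definition mixed_step_proj (e : bool) (A B : permGroup) :
    {morphism [set: grp (mixed_step e A B)] >-> grp B} :=
  match e with
  | true => wreath_proj A B
  | false => wreath_proj A B
  end.

Definition at_most_generated (gT : finGroupType) (G : {group gT}) (d : int) :=
  exists2 X : {set gT}, (#|X|%:Z <= d)%R & <<X>> = G.

From mathcomp Require Import all_classical all_reals all_analysis.

Section MixedWreath.
Variables (m : nat -> nat) (S : forall k, {group {perm 'I_(m k)}}).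
Variable kk : nat -> nat.

(** Membership of [k] in the set {kk 1, kk 2, ...}. *)
Definition in_kseq (k : nat) : bool := `[< exists2 n, (0 < n)%N & kk n = k >].

(** The families [m], [S] and [kk] are indexed from 1, their values at 0 being
    ignored; [mixed_wreath n] is the group G_(n+1), with G_1 = S_1. *)
Fixpoint mixed_wreath (n : nat) : permGroup :=
  match n with
  | 0 => permGroup_of (S 1)
  | n'.+1 => mixed_step (in_kseq n.+1) (permGroup_of (S n.+1)) (mixed_wreath n')
  end.

Definition mixed_proj (n : nat) :
    {morphism [set: grp (mixed_wreath n.+1)]%SET >-> grp (mixed_wreath n)} :=
  mixed_step_proj (in_kseq n.+2) (permGroup_of (S n.+2)) (mixed_wreath n).
End MixedWreath.

Local Open Scope classical_set_scope.

HB.mixin Record isTopologicalGroup G of monoid.Group G & Topological G := {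
  mulg_continuous : continuous (fun xy : G * G => xy.1 * xy.2);
  invg_continuous : continuous (fun x : G => x^-1)
}.

#[short(type="topologicalGroupType")]
HB.structure Definition TopologicalGroup :=
  {G of isTopologicalGroup G & monoid.Group G & Topological G}.

Definition abstract_subgroup (G : groupType) (X : set G) : set G :=
  smallest [set H : set G | group_closed [in H]] X.

Definition topologically_generates (G : topologicalGroupType) (X : set G) :=
  closure (abstract_subgroup X) = setT.

Definition topologically_at_most_generated (G : topologicalGroupType) (d : int) :=
  exists X : seq G, ((size X)%:Z <= d)%R /\ topologically_generates [set` X].

Definition topologically_finitely_generated (G : topologicalGroupType) :=
  exists2 X : set G, finite_set X & topologically_generates X.

Section InverseLimit.
Variables (gT : nat -> finGroupType)
          (p : forall n, {morphism [set: gT n.+1]%SET >-> gT n}).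

Record invlim := Invlim {
  coords : forall n, gT n;
  coords_compat : forall n, p n (coords n.+1) = coords n
}.

Lemma coords_inj : injective coords.
Proof.
by case=> x hx [y hy] /= exy; subst y; congr Invlim; exact: Prop_irrelevance.
Qed.

Lemma invlim_one_compat n : p n 1 = 1 :> gT n.
Proof. exact: morph1. Qed.

Lemma invlim_inv_compat (x : invlim) n :
  p n (coords x n.+1)^-1 = (coords x n)^-1.
Proof. by rewrite morphV ?inE // coords_compat. Qed.

Lemma invlim_mul_compat (x y : invlim) n :
  p n (coords x n.+1 * coords y n.+1) = coords x n * coords y n.
Proof. by rewrite morphM ?inE // !coords_compat. Qed.

Definition invlim_one := @Invlim (fun=> 1) invlim_one_compat.
Definition invlim_inv x := Invlim (invlim_inv_compat x).
Definition invlim_mul x y := Invlim (invlim_mul_compat x y).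

Lemma invlim_eq (x y : invlim) : (forall n, coords x n = coords y n) -> x = y.
Proof. by move=> exy; apply/coords_inj/functional_extensionality_dep. Qed.

Lemma invlim_mulA : associative invlim_mul.
Proof. by move=> x y z; apply: invlim_eq => n; exact: mulgA. Qed.
Lemma invlim_mul1 : left_id invlim_one invlim_mul.
Proof. by move=> x; apply: invlim_eq => n; exact: mul1g. Qed.
Lemma invlim_mulx1 : right_id invlim_one invlim_mul.
Proof. by move=> x; apply: invlim_eq => n; exact: mulg1. Qed.
Lemma invlim_mulV : left_inverse invlim_one invlim_inv invlim_mul.
Proof. by move=> x; apply: invlim_eq => n; exact: mulVg. Qed.
Lemma invlim_mulxV : right_inverse invlim_one invlim_inv invlim_mul.
Proof. by move=> x; apply: invlim_eq => n; exact: mulgV. Qed.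

HB.instance Definition _ := gen_eqMixin invlim.
HB.instance Definition _ := gen_choiceMixin invlim.
HB.instance Definition _ := isGroup.Build invlim
  invlim_mulA invlim_mul1 invlim_mulx1 invlim_mulV invlim_mulxV.

(** The subspace topology of the product of the finite discrete groups. *)
HB.instance Definition _ := Topological.copy invlim
  (initial_topology
    (coords : invlim -> prod_topology (fun n => discrete_topology (gT n)))).

Lemma coord_nbhs (x : invlim) n : nbhs x [set y | coords y n = coords x n].
Proof.
have c : continuous (fun y : invlim => coords y n : discrete_topology (gT n)).
  move=> y; apply: (@continuous_comp _ _ _ _
    (proj n : prod_topology (fun n => discrete_topology (gT n)) -> _)).
    exact: initial_continuous.
  exact: proj_continuous.
exact: (c x _ (discrete_set1 (coords x n : discrete_topology (gT n)))).
Qed.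

Lemma invlim_continuous (X : topologicalType) (f : X -> invlim) :
  (forall n x, \forall y \near x, coords (f y) n = coords (f x) n) ->
  continuous f.
Proof.
move=> cf; apply: continuous_comp_initial => x; apply/cvg_sup => n.
move: x; apply/(@continuousP _ (initial_topology (@^~ n))) => A [B ? E].
rewrite -E openE => x /= Bx; rewrite /interior.
by apply: filterS (cf n x) => y /= eyx; rewrite /= eyx.
Qed.

Lemma invlim_mul_continuous :
  continuous (fun xy : invlim * invlim => xy.1 * xy.2).
Proof.
apply: invlim_continuous => n [x y].
exists ([set z | coords z n = coords x n], [set z | coords z n = coords y n]).
  by split; exact: coord_nbhs.
by move=> [a b] /= [<- <-].
Qed.

Lemma invlim_inv_continuous : continuous (fun x : invlim => x^-1).
Proof.
apply: invlim_continuous => n x.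
by apply: filterS (coord_nbhs x n) => y /= <-.
Qed.

HB.instance Definition _ := isTopologicalGroup.Build invlim
  invlim_mul_continuous invlim_inv_continuous.

End InverseLimit.

Definition mixed_wreath_limit (m : nat -> nat)
    (S : forall k, {group {perm 'I_(m k)}}) (kk : nat -> nat) :
    topologicalGroupType :=
  invlim (mixed_proj S kk).

Definition stride_at_most (kk : nat -> nat) (m : int) :=
  forall n, (0 < n)%N -> ((kk n.+1)%:Z - (kk n)%:Z <= m)%R.

(* Main.v *)
Require Import Defs.
From mathcomp Require Import all_boot all_order all_algebra all_fingroup all_solvable.
From mathcomp Require Import zify.

Set Implicit Arguments.
Unset Strict Implicit.
Unset Printing Implicit Defensive.

Local Open Scope group_scope.

(** Write G_k for the k-th group, Omega_k for the set it acts on, and, for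
    u in S_{k+1} and Z contained in Omega_k, write u(Z) for the element of the
    base group S_{k+1}^Omega_k with entry u on Z and 1 off Z; it is an element
    of G_{k+1}.  As the stabilisers in S_k are not all equal, there are points
    x_k, y_k and an element a_k of S_k that fixes x_k and moves y_k.

    Two disjoint subsets of every Omega_k are defined: the anchor X_k and the
    support Y_k.  At the bottom X_1 = Omega_1 and Y_1 is empty; after that
    X_{k+1} and Y_{k+1} are the cylinders over X_k at x_{k+1} and at y_{k+1}
    (for an exponentiation, the functions that take this constant value on
    X_k; for a permutational wreath product, the points above X_k with this
    first coordinate).  If s_1, ..., s_D generate S_k at each level, the limit
    is generated by
    - the D elements b_i, product of s_i in S_1 and of all the s_i(Y_k),
    - the element c, product of all the a_{k+1}(X_k),
    - D - 1 elements f_j of the base group of G_2.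
    That is 2D elements, whatever the stride.

    Being a cylinder over X_k, both X_{k+1} and Y_{k+1} are preserved by every
    u(Z) with Z disjoint from X_k.  So the factors of the b_i at different
    levels commute, and so does c with the lowest factor of every b_i.  But
    a_{k+1}(X_k) preserves X_{k+1} and moves Y_{k+1} off itself, so that in
    the commutator of b_i with the conjugate of b_j by c all the factors
    cancel except the lowest one, which becomes [s_i, s_j].  As S_1 is
    perfect these commutators yield S_1 with no tail at higher levels.  The
    b_i and c may then be divided by their lowest factors, and the argument
    restarts one level up: once the whole of G_k is available without tails,
    one obtains s(Y_k) for all s in S_{k+1}, its conjugates s(Y_k^g), and, by
    taking commutators again, s(Z) for Z an intersection of translates of
    Y_k.  These translates separate points, so the whole base group follows.
    The empty Y_1 gives nothing at level 2: this is what the f_j are for.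

    The bookkeeping of the tails is the predicate [absorbs]: it speaks of an
    arbitrary group containing an image of G_k, in which the generators are
    multiplied by tails of which only commutation rules are known.  This
    predicate passes from G_k to G_{k+1} ([absorbs_step]), and with trivial
    tails it says that G_k is generated. *)

(** * Density in an inverse limit *)

Module InverseLimitDensity.
From mathcomp Require Import all_classical all_reals all_analysis.
Local Open Scope classical_set_scope.
Section InvLim.
Variables (gT : nat -> finGroupType)
          (p : forall n, {morphism [set: gT n.+1]%SET >-> gT n}).
Local Notation L := (invlim p).

Lemma coords_le (x y : L) m n : (m <= n)%N ->
  coords x n = coords y n -> coords x m = coords y m.
Proof.
elim: n => [|n IHn]; first by rewrite leqn0 => /eqP ->.
rewrite leq_eqVlt => /predU1P[-> //|]; rewrite ltnS => mn xy.
by apply: IHn => //; rewrite -(coords_compat x n) -(coords_compat y n) xy.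
Qed.

Lemma invlim_cvg (y : nat -> L) (x : L) :
  (forall n, coords (y n) n = coords x n) -> y @ \oo --> x.
Proof.
move=> yx A [_ [[C Cop <-] Cx] CA].
have: (fun n => coords (y n)) @ \oo -->
    (coords x : prod_topology (fun n => discrete_topology (gT n))).
  apply/cvg_sup => n.
  move=> B [_ [[D Dop <-] Dx] DB].
  exists n => // k /= nk; apply: DB => /=.
  rewrite (_ : coords (y k) n = coords x n) //.
  exact: coords_le nk (yx k).
move/(_ C); case.
  by apply: open_nbhs_nbhs; split.
by move=> n _ nC; exists n => // k /nC Ck; apply: CA.
Qed.

(** Density is tested one coordinate at a time: an element is the limit of any
    sequence whose n-th term agrees with it at n, hence at all m <= n. *)
Lemma topologically_generates_coords (X : seq L) :
  (forall n (H : {group gT n}), (forall x, x \in X -> coords x n \in H) ->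
     forall g, g \in H) ->
  topologically_generates [set` X].
Proof.
move=> gen; pose G := abstract_subgroup [set` X].
have G1 : G 1 by move=> H [[H1 _] _]; rewrite inE in H1.
have GV x y : G x -> G y -> G (x * y^-1).
  move=> Gx Gy H HX; have [[_ HB] _] := HX.
  by have := HB x y; rewrite !inE; apply; [exact: Gx | exact: Gy].
have onto n g : exists2 y, G y & coords y n = g.
  pose K := [set g : gT n | `[< exists2 y, G y & coords y n = g >]]%SET.
  have KP h : reflect (exists2 y, G y & coords y n = h) (h \in K).
    by rewrite finset.in_set; exact: asboolP.
  have Kg : group_set K.
    apply/group_setP; split=> [|u v]; first by apply/KP; exists 1.
    move=> /KP[x Gx <-] /KP[y Gy <-]; apply/KP; exists (x * y) => //.
    rewrite -[y]invgK; apply: (GV _ _ Gx).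
    by rewrite -[y^-1]mul1g; exact: GV.
  apply/KP; apply: (gen n (Group Kg)) => x Xx /=.
  by apply/KP; exists x => // H [_]; apply.
apply/seteqP; split=> // x _.
have approx n : exists z, G z /\ coords z n = coords x n.
  by have [z] := onto n (coords x n); exists z.
have [y yP] := boolp.choice approx.
have yx : y @ \oo --> x by apply: invlim_cvg => n; case: (yP n).
move=> B /yx[n _ nB]; exists (y n); split; first by case: (yP n).
exact: nB (leqnn n).
Qed.

Lemma finitely_generated_coords (X : seq L) (d : int) :
  (forall n (H : {group gT n}), (forall x, x \in X -> coords x n \in H) ->
     forall g, g \in H) ->
  ((size X)%:Z <= d)%R ->
  topologically_finitely_generated L /\ topologically_at_most_generated L d.
Proof.
move=> /topologically_generates_coords Xgen Xd.
by split; [exists [set` X] => //; exact: finite_seq | exists X].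
Qed.

End InvLim.
End InverseLimitDensity.

Import InverseLimitDensity.

(** * Morphisms, commutators and perfect groups *)

(** The morphisms below are plain functions, total on their domain, as they are
    composed and specialised repeatedly. *)
Section Morph.
Variables (gT hT : finGroupType) (f : gT -> hT).
Hypothesis fM : {morph f : x y / x * y}.

Lemma morph_one : f 1 = 1.
Proof. by apply: (mulgI (f 1)); rewrite -fM !mulg1. Qed.

Lemma morph_inv x : f x^-1 = (f x)^-1.
Proof. by apply: (mulgI (f x)); rewrite -fM !mulgV morph_one. Qed.

Lemma morph_conj x y : f (x ^ y) = f x ^ f y.
Proof. by rewrite /conjg !fM morph_inv. Qed.

Lemma morph_comm x y : f [~ x, y] = [~ f x, f y].
Proof. by rewrite /commg fM morph_inv morph_conj. Qed.

Lemma morph_commute x y : commute x y -> commute (f x) (f y).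
Proof. by rewrite /commute -!fM => ->. Qed.

Definition preim_set (H : {group hT}) := [set x | f x \in H].

Lemma preim_group_set H : group_set (preim_set H).
Proof.
apply/group_setP; split=> [|x y]; first by rewrite inE morph_one group1.
by rewrite !inE fM => *; rewrite groupM.
Qed.

Definition preim_group H := Group (preim_group_set H).

Lemma mem_preim_group H x : (x \in preim_group H) = (f x \in H).
Proof. by rewrite inE. Qed.

End Morph.

Lemma commute_conjg (gT : finGroupType) (x y : gT) : commute x y -> x ^ y = x.
Proof. by move=> cxy; rewrite /conjg cxy mulKg. Qed.

Lemma conjg_fix_commute (gT : finGroupType) (x y : gT) : x ^ y = x -> commute x y.
Proof. by move=> xy; rewrite /commute -{2}xy mulgA mulgV mul1g. Qed.

Lemma commute_conj (gT : finGroupType) (x y z : gT) :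
  commute x y -> commute (x ^ z) (y ^ z).
Proof. by rewrite /commute -!conjMg => ->. Qed.

Lemma commg_mul_commute (gT : finGroupType) (a b a' b' : gT) :
  commute a b -> commute a b' -> commute a' b -> commute a' b' ->
  commute b b' -> [~ a * b, a' * b'] = [~ a, a'].
Proof.
move=> ab ab' a'b a'b' bb'.
have bx : commute b (a' * b') by apply: commuteM => //; exact: commute_sym.
rewrite commMgJ (eqP (introT commgP bx)) mulg1 commgMJ.
rewrite (eqP (introT commgP ab')) mul1g -conjgM commute_conjg //.
have c1 : commute a (b' * b) by exact: commuteM.
have c2 : commute a' (b' * b) by exact: commuteM.
by apply/commute_sym; do !apply: commuteM; do ?apply: commuteV; apply: commute_sym.
Qed.

(** The elements sent into H form a subgroup normalised by all the generators,
    and modulo this subgroup the generators commute; a perfect group has no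
    nontrivial abelian quotient. *)
Lemma perfect_absorb (gT hT : finGroupType) (I : finType) (s : I -> gT)
    (phi : gT -> hT) (H : {group hT}) :
  {morph phi : x y / x * y} ->
  [~: [set: gT], [set: gT]] = [set: gT] ->
  <<[set s i | i : I]>> = [set: gT] ->
  (forall i, exists2 h, h \in H & forall u, phi u ^ h = phi (u ^ s i)) ->
  (forall i j, phi [~ s i, s j] \in H) ->
  forall u, phi u \in H.
Proof.
move=> phiM perf gen norm comm u.
rewrite -(mem_preim_group phiM); set K := preim_group _ _.
have nK : [set: gT] \subset 'N(K).
  rewrite -gen gen_subG; apply/subsetP => _ /imsetP[i _ ->].
  rewrite inE; apply/subsetP => _ /imsetP[v Kv ->].
  have [h Hh phi_h] := norm i; move: Kv.
  by rewrite !mem_preim_group -phi_h => Kv; rewrite groupJ.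
suff /subsetP : [set: gT] \subset K by apply; rewrite inE.
have abK : abelian (<<[set s i | i : I]>> / K).
  rewrite quotient_gen; last by rewrite -gen_subG gen.
  rewrite abelian_gen abelianE; apply: quotient_cents2r.
  rewrite gen_subG.
  apply/subsetP => _ /imset2P[_ _ /imsetP[i _ ->] /imsetP[j _ ->] ->].
  by rewrite mem_preim_group.
rewrite -{1}perf; apply: (@der1_min _ [set: gT]%G) => //.
by rewrite gen in abK.
Qed.

Lemma perfect_commutators (gT : finGroupType) (K : {group gT}) :
  [~: [set: gT], [set: gT]] = [set: gT] ->
  (forall u v, [~ u, v] \in K) -> forall u, u \in K.
Proof.
move=> perf comm u; suff /subsetP : [set: gT] \subset K by apply; rewrite inE.
by rewrite -perf gen_subG; apply/subsetP => _ /imset2P[x y _ _ ->].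
Qed.

(** * Elements of the base group that are constant on a set *)

Definition preserves (B : permGroup) (X : {set pts B}) (g : grp B) :=
  forall w, (pact B w g \in X) = (w \in X).

Lemma preserves1 (B : permGroup) (X : {set pts B}) : preserves X 1.
Proof. by move=> w; rewrite act1. Qed.

Lemma preservesM (B : permGroup) (X : {set pts B}) g h :
  preserves X g -> preserves X h -> preserves X (g * h).
Proof. by move=> Xg Xh w; rewrite actM Xh Xg. Qed.

Lemma preservesV (B : permGroup) (X : {set pts B}) g :
  preserves X g -> preserves X g^-1.
Proof. by move=> Xg w; rewrite -Xg actKV. Qed.

Definition shift (B : permGroup) (Z : {set pts B}) (q : grp B) : {set pts B} :=
  [set w | pact B w q^-1 \in Z].

Lemma shift_preserved (B : permGroup) (X : {set pts B}) g :
  preserves X g -> shift X g = X.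
Proof. by move/preservesV=> Xg; apply/setP=> w; rewrite inE Xg. Qed.

Section Loc.
Variables A B : permGroup.

Definition loc (u : grp A) (Z : {set pts B}) : base_group A B :=
  [ffun t => if t \in Z then u else 1].

Lemma locM Z : {morph loc^~ Z : u v / u * v}.
Proof.
by move=> u v; apply/ffunP => t; rewrite !ffunE; case: ifP; rewrite ?mulg1.
Qed.

Lemma loc_comm u v (Z Z' : {set pts B}) :
  [~ loc u Z, loc v Z'] = loc [~ u, v] (Z :&: Z').
Proof.
apply/ffunP => t; rewrite !ffunE inE.
by do 2!case: ifP; rewrite ?invg1 ?mul1g ?mulg1 ?mulVg.
Qed.

Lemma loc0 u : loc u set0 = 1.
Proof. by apply/ffunP => t; rewrite !ffunE inE. Qed.

Lemma loc1 Z : loc 1 Z = 1.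
Proof. by apply/ffunP => t; rewrite !ffunE; case: ifP. Qed.

Lemma loc_shift u Z q : base_perm (loc u Z) q = loc u (shift Z q).
Proof. by apply/ffunP => t; rewrite !ffunE inE. Qed.

Lemma loc_commute u v (Z Z' : {set pts B}) : (forall w, w \in Z -> w \notin Z') ->
  commute (loc u Z) (loc v Z').
Proof.
move=> dZ; apply/commgP; rewrite loc_comm.
suff -> : Z :&: Z' = set0 by rewrite loc0.
by apply/setP => w; rewrite !inE; case: (boolP (w \in Z)) => //= /dZ/negPf.
Qed.

End Loc.

(** * Generating a wreath product from its top group *)

(** The wreath product is given by its two factors [top] and [bas] and the way
    they multiply, so that the same proofs serve for both of its actions. *)
Section WreathLike.
Variables (A B : permGroup) (W : finGroupType).
Variables (top : grp B -> W) (bas : base_group A B -> W).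
Hypothesis basM : {morph bas : x y / x * y}.
Hypothesis bas_top : forall f q, bas f ^ top q = bas (base_perm f q).
Hypothesis wreathE : forall w, exists q f, w = top q * bas f.
Variable K : {group W}.
Hypothesis topK : forall q, top q \in K.

Lemma wreath_full : (forall t u, bas (loc u [set t]) \in K) -> forall w, w \in K.
Proof.
move=> locK w; have [q [f ->]] := wreathE w; rewrite groupM // {w q}.
suff supp_r (r : seq (pts B)) : forall f : base_group A B,
    (forall t, t \notin r -> f t = 1) -> bas f \in K.
  by apply: (supp_r (enum (pts B))) => t; rewrite mem_enum.
elim: r => [|t r IHr] {}f f1.
  have -> : f = 1 by apply/ffunP => t; rewrite f1 ?ffunE.
  by rewrite (morph_one basM) group1.
pose f' : base_group A B := [ffun t' => if t' == t then 1 else f t'].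
have -> : f = loc (f t) [set t] * f'.
  apply/ffunP => t'; rewrite !ffunE inE.
  by case: eqP => [->|_]; rewrite ?mulg1 ?mul1g.
rewrite basM groupM // IHr // => t' rt'; rewrite ffunE.
by case: eqP => // /eqP nt; rewrite f1 // inE negb_or nt.
Qed.

Hypothesis Aperf : [~: [set: grp A], [set: grp A]] = [set: grp A].

Definition separating (Y : {set pts B}) := forall w w', exists q,
  pact B w q \in Y /\ (w' != w -> pact B w' q \notin Y).

(** As A is perfect, the sets Z with u(Z) in K for all u are closed under
    intersection; intersecting translates of Y leads to single points. *)
Lemma wreath_full_separating (Y : {set pts B}) : separating Y ->
  (forall u, bas (loc u Y) \in K) -> forall w, w \in K.
Proof.
move=> sepY YK.
have locI (Z Z' : {set pts B}) : (forall u, bas (loc u Z) \in K) ->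
    (forall u, bas (loc u Z') \in K) -> forall u, bas (loc u (Z :&: Z')) \in K.
  move=> ZK ZK'; pose phi u := bas (loc u (Z :&: Z')).
  have phiM : {morph phi : x y / x * y} by move=> x y; rewrite /phi locM basM.
  move=> u; rewrite -/(phi u) -(mem_preim_group phiM).
  apply: perfect_commutators => // x y; rewrite mem_preim_group /phi -loc_comm.
  by rewrite (morph_comm basM) groupR.
have shiftK q u : bas (loc u (shift Y q)) \in K.
  by rewrite -loc_shift -bas_top groupJ.
apply: wreath_full => t.
have [Z [[Zt Znt] ZK]] : exists Z : {set pts B}, (t \in Z /\
   forall t', t' \in enum (pts B) -> t' != t -> t' \notin Z) /\
   forall u, bas (loc u Z) \in K.
  elim: (enum _) => [|t' r [Z [[Zt Zr] ZK]]].
    have [q [Yq _]] := sepY t t; exists (shift Y q^-1).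
    by split=> //; split=> //; rewrite inE invgK.
  have [q [Yq Yq']] := sepY t t'; exists (Z :&: shift Y q^-1).
  split; last exact: locI.
  split=> [|t'']; first by rewrite !inE Zt invgK.
  rewrite !inE invgK => /orP[/eqP -> /Yq'/negPf -> | /Zr rt /rt/negPf -> //].
  by rewrite andbF.
suff <- : Z = [set t] by [].
apply/setP => t'; rewrite inE; case: eqP => [-> //|/eqP nt].
by apply: negbTE; apply: Znt => //; rewrite mem_enum.
Qed.

End WreathLike.

(** * Generators with unknown tails *)

(** The group E stands for G_N with N large and [iota] for the embedding of W
    as one of the groups below it; [beta i] and [gamma] are the parts of b_i
    and c at the higher levels, whose lowest factors are s_i(Y) and a(X).  The
    hypotheses are commutation rules that hold because the higher anchors and
    supports are cylinders over X: an element preserving X, respectively X and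
    Y, commutes with the tail of c, respectively of b_i; and if q preserves X
    and moves Y off itself, then q followed by the tail of c moves all the
    supports in the tails off themselves. *)
Definition absorbs (W : permGroup) (X Y : {set pts W}) (I J : Type)
    (b : I -> grp W) (c : grp W) (f : J -> grp W) :=
  forall (E : finGroupType) (iota : grp W -> E) (beta : I -> E) (gamma : E)
    (H : {group E}),
  {morph iota : x y / x * y} ->
  (forall q, preserves X q -> commute (iota q) gamma) ->
  (forall q i, preserves X q -> preserves Y q -> commute (iota q) (beta i)) ->
  (forall q i j, preserves X q -> (forall w, w \in Y -> pact W w q \notin Y) ->
     commute (beta i) (beta j ^ (iota q * gamma))) ->
  (forall i, iota (b i) * beta i \in H) -> iota c * gamma \in H ->
  (forall j, iota (f j) \in H) ->
  forall g, iota g \in H.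

(** W is a wreath product over B; X' and Y' are the anchor and the support in
    W, and the hypotheses on them are the properties of cylinders. *)
Section Step.
Variables (A B W : permGroup).
Variables (top : grp B -> grp W) (bas : base_group A B -> grp W).
Hypothesis topM : {morph top : x y / x * y}.
Hypothesis basM : {morph bas : x y / x * y}.
Hypothesis bas_top : forall f q, bas f ^ top q = bas (base_perm f q).
Hypothesis wreathE : forall w, exists q f, w = top q * bas f.
Variables (X Y : {set pts B}) (X' Y' : {set pts W}) (I : finType) (J : Type).
Variables (s : I -> grp A) (a : grp A).
Hypothesis XY : forall w, w \in Y -> w \notin X.
Hypothesis topXY : forall q, preserves X q ->
  preserves X' (top q) /\ preserves Y' (top q).
Hypothesis locXY : forall u (Z : {set pts B}), (forall w, w \in Z -> w \notin X) ->
  preserves X' (bas (loc u Z)) /\ preserves Y' (bas (loc u Z)).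
Hypothesis aX : preserves X' (bas (loc a X)).
Hypothesis aY : forall w, w \in Y' -> pact W w (bas (loc a X)) \notin Y'.
Hypothesis Aperf : [~: [set: grp A], [set: grp A]] = [set: grp A].
Hypothesis Agen : <<[set s i | i : I]>> = [set: grp A].

Variables (b : I -> grp B) (c : grp B) (f : J -> grp B).

(** Tails for W become tails for B when the new factors s_i(Y) and a(X) are
    put in front of them. *)
Section Extension.
Variables (E : finGroupType) (iota : grp W -> E) (beta : I -> E) (gamma : E).
Hypothesis iotaM : {morph iota : x y / x * y}.
Hypothesis gammaP : forall q, preserves X' q -> commute (iota q) gamma.
Hypothesis betaP : forall q i, preserves X' q -> preserves Y' q ->
  commute (iota q) (beta i).
Hypothesis beta_gammaP : forall q i j, preserves X' q ->
  (forall w, w \in Y' -> pact W w q \notin Y') ->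
  commute (beta i) (beta j ^ (iota q * gamma)).

Local Notation lam u Z := (iota (bas (loc u Z))).
Let beta' i := lam (s i) Y * beta i.
Let gamma' := lam a X * gamma.

(** All the tails cancel.  For q = 1 this produces the elements [s_i, s_j](Y)
    of the base group; if q moves Y off itself the intersection is empty, and
    this is the commutation rule required to go down from W to B. *)
Lemma commutator_pure q i j : preserves X q ->
  [~ beta' i, beta' j ^ (iota (top q) * gamma')] =
  lam [~ s i, s j] (Y :&: shift Y q).
Proof.
move=> Xq; pose q' := top q * bas (loc a X).
have XYq p : preserves X p -> forall w, w \in shift Y p -> w \notin X.
  by move=> Xp w; rewrite inE => /XY; rewrite (preservesV Xp).
(* An element of the base group that avoids X does not see the tails. *)
have off u (Z : {set pts B}) i0 : (forall w, w \in Z -> w \notin X) ->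
    commute (lam u Z) gamma /\ commute (lam u Z) (beta i0).
  by move=> /(locXY u)[? ?]; split; [exact: gammaP | exact: betaP].
have lam_conj u Z p : (forall w, w \in shift Z p -> w \notin X) ->
    lam u (shift Z p) = lam u Z ^ (iota (top p) * gamma').
  move=> Zp; rewrite /gamma' !conjgM -(morph_conj iotaM) bas_top loc_shift.
  rewrite (@commute_conjg _ (lam u _) (lam a X)).
    by rewrite commute_conjg //; case: (off u _ i Zp).
  by apply/(morph_commute iotaM)/(morph_commute basM)/loc_commute.
have kE : iota (top q) * gamma' = iota q' * gamma by rewrite /gamma' iotaM mulgA.
rewrite [beta' j ^ _]conjMg -lam_conj /beta'; last exact: XYq.
rewrite commg_mul_commute.
- by rewrite -(morph_comm iotaM) -(morph_comm basM) loc_comm.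
- by case: (off (s i) _ i XY).
- have YE : shift (shift Y q^-1) q = Y.
    by apply/setP => w; rewrite !inE invgK actKV.
  (* Conjugating both sides back turns Y into its translate by the inverse of
     q, which still avoids X. *)
  rewrite -[Y in lam _ Y]YE lam_conj ?YE //; apply: commute_conj.
  by case: (off (s i) _ j (XYq _ (preservesV Xq))).
- by case: (off (s j) _ i (XYq _ Xq)).
- rewrite lam_conj; last exact: XYq.
  by apply: commute_conj; case: (off (s j) _ j XY).
- rewrite kE; apply: beta_gammaP.
    by apply: preservesM => //; case: (topXY Xq).
  by move=> w Yw; rewrite actM aY //; case: (topXY Xq) => _ ->.
Qed.

Variable H : {group E}.
Hypothesis Hb : forall i, iota (top (b i) * bas (loc (s i) Y)) * beta i \in H.
Hypothesis Hc : iota (top c * bas (loc a X)) * gamma \in H.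
Hypothesis Hf : forall j, iota (top (f j)) \in H.

Lemma top_absorbed : absorbs X Y b c f -> forall q, iota (top q) \in H.
Proof.
move=> abs; apply: (abs E (iota \o top) beta' gamma') => //=.
- by move=> p q; rewrite /= topM iotaM.
- move=> q Xq; apply: commuteM; last by apply: gammaP; case: (topXY Xq).
  apply: (morph_commute iotaM); apply/commute_sym/conjg_fix_commute.
  by rewrite bas_top loc_shift shift_preserved.
- move=> q i Xq Yq; apply: commuteM; last by apply: betaP; case: (topXY Xq).
  apply: (morph_commute iotaM); apply/commute_sym/conjg_fix_commute.
  by rewrite bas_top loc_shift shift_preserved.
- move=> q i j Xq Yq; apply/commgP; rewrite commutator_pure //.
  suff -> : Y :&: shift Y q = set0 by rewrite loc0 (morph_one basM) (morph_one iotaM).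
  apply/setP => w; rewrite !inE; apply/negP => /andP[Yw /Yq].
  by rewrite actKV Yw.
- by move=> i; rewrite /beta' mulgA -iotaM.
- by rewrite /gamma' mulgA -iotaM.
Qed.

Lemma support_absorbed : (forall q, iota (top q) \in H) -> forall u, lam u Y \in H.
Proof.
move=> Htop.
have Hb' i : beta' i \in H.
  by rewrite -(groupMl _ (Htop (b i))) /beta' mulgA -iotaM.
have Hc' : gamma' \in H.
  by rewrite -(groupMl _ (Htop c)) /gamma' mulgA -iotaM.
apply: (@perfect_absorb _ _ I s (fun u => lam u Y)) => //.
- by move=> u v /=; rewrite locM basM iotaM.
- move=> i; exists (beta' i) => // u.
  rewrite conjgM -(morph_conj iotaM) -(morph_conj basM) -(morph_conj (locM Y)).
  apply: commute_conjg; have [? ?] := locXY (u ^ s i) XY; exact: betaP.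
- move=> i j; have := commutator_pure i j (preserves1 X).
  rewrite (shift_preserved (preserves1 Y)) setIid => <-.
  by rewrite groupR // groupJ // groupM.
Qed.

End Extension.

Hypothesis abs : absorbs X Y b c f.
Let b' i := top (b i) * bas (loc (s i) Y).
Let c' := top c * bas (loc a X).

(** One level up: first B is absorbed without tails, then the copy of A on Y,
    then everything. *)
Lemma absorbs_step :
  separating Y -> absorbs X' Y' b' c' (fun j => top (f j)).
Proof.
move=> sepY E iota beta gamma H iotaM P1 P2 P3 Hb Hc Hf g.
have Htop := top_absorbed iotaM P1 P2 P3 Hb Hc Hf abs.
have Hloc := support_absorbed iotaM P1 P2 P3 Hb Hc Htop.
rewrite -(mem_preim_group iotaM).
by apply: (wreath_full_separating basM bas_top wreathE _ Aperf sepY) => ?;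
  rewrite mem_preim_group.
Qed.

(** The variant for the second level, where Y is empty and further generators
    have to provide the base group. *)
Lemma absorbs_seed (J' : Type) (f' : J' -> grp W) :
  (forall j, f j = 1) ->
  (forall K : {group grp W}, (forall q, top q \in K) ->
     (forall j, f' j \in K) -> forall w, w \in K) ->
  absorbs X' Y' b' c' f'.
Proof.
move=> f1 full E iota beta gamma H iotaM P1 P2 P3 Hb Hc Hf g.
have Htop : forall q, iota (top q) \in H.
  apply: (top_absorbed iotaM P1 P2 P3 Hb Hc _ abs) => j.
  by rewrite f1 (morph_one topM) (morph_one iotaM) group1.
rewrite -(mem_preim_group iotaM).
by apply: full => ?; rewrite mem_preim_group.
Qed.

End Step.

(** At the bottom every element preserves the anchor, so that nothing
    interacts with the tails. *)
Lemma absorbs_bottom (A : permGroup) (I : finType) (J : Type) (s : I -> grp A) :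
  [~: [set: grp A], [set: grp A]] = [set: grp A] ->
  <<[set s i | i : I]>> = [set: grp A] ->
  absorbs [set: pts A] set0 s 1 (fun _ : J => 1).
Proof.
move=> Aperf Agen E iota beta gamma H iotaM P1 P2 P3 Hb Hc _.
have XT q : preserves [set: pts A] q by move=> w; rewrite !inE.
have Y0 q : preserves (set0 : {set pts A}) q by move=> w; rewrite !inE.
have {}P1 q : commute (iota q) gamma by apply: P1.
have {}P2 q i : commute (iota q) (beta i) by apply: P2.
move: Hc; rewrite (morph_one iotaM) mul1g => Hc.
have {}P3 i j : commute (beta i) (beta j ^ gamma).
  have := P3 1 i j (XT 1); rewrite (morph_one iotaM) mul1g.
  by apply=> w; rewrite inE.
apply: (perfect_absorb iotaM Aperf Agen) => [i | i j].
  exists (iota (s i) * beta i) => // u.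
  by rewrite conjgM -(morph_conj iotaM) (commute_conjg (P2 _ _)).
have -> : iota [~ s i, s j]
    = [~ iota (s i) * beta i, (iota (s j) * beta j) ^ gamma].
  rewrite conjMg (commute_conjg (P1 _)) commg_mul_commute ?(morph_comm iotaM) //.
  - by rewrite -(commute_conjg (P1 (s i))); apply: commute_conj.
  - by rewrite -{1}(commute_conjg (P1 (s j))); apply: commute_conj.
by rewrite groupR // groupJ.
Qed.

(** * The two wreath products and their cylinders *)

Section MixedStep.
Variables (e : bool) (A B : permGroup).
Local Notation W := (mixed_step e A B).

Lemma wreath_pair_proof (q : grp B) (f : base_group A B) :
  (q, f) \in setX [set: grp B] [set: base_group A B].
Proof. by rewrite inE !in_setT. Qed.

Definition wreath_pair q f : wreath A B := SdPair _ (wreath_pair_proof q f).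

Definition step_elt (q : grp B) (f : base_group A B) : grp W :=
  match e return grp (mixed_step e A B) with
  | true => wreath_pair q f
  | false => wreath_pair q f
  end.

Lemma step_eltM q f q' f' :
  step_elt q f * step_elt q' f' = step_elt (q * q') (base_perm f q' * f').
Proof. by rewrite /step_elt; case: e; apply: val_inj. Qed.

Lemma step_eltP w : exists q f, w = step_elt q f.
Proof.
rewrite /step_elt; move: w; case: e => -[[q f] p];
  by exists q, f; apply: val_inj.
Qed.

Definition step_top q := step_elt q 1.
Definition step_bas f := step_elt 1 f.

Lemma base_perm_one q : base_perm (1 : base_group A B) q = 1.
Proof. by apply/ffunP => t; rewrite !ffunE. Qed.

Lemma base_perm_id (f : base_group A B) : base_perm f 1 = f.
Proof. exact: base_perm1. Qed.

Lemma step_topM : {morph step_top : x y / x * y}.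
Proof. by move=> x y; rewrite step_eltM base_perm_one mulg1. Qed.

Lemma step_basM : {morph step_bas : x y / x * y}.
Proof. by move=> x y; rewrite step_eltM base_perm_id mulg1. Qed.

Lemma step_bas_top f q : step_bas f ^ step_top q = step_bas (base_perm f q).
Proof.
apply: (mulgI (step_top q)); rewrite -conjgC !step_eltM.
by rewrite !mul1g !mulg1 base_perm_id mul1g.
Qed.

Lemma step_wreathE w : exists q f, w = step_top q * step_bas f.
Proof.
have [q [f ->]] := step_eltP w; exists q, f.
by rewrite step_eltM base_perm_id mulg1 mul1g.
Qed.

Lemma mixed_step_projE q f : mixed_step_proj e A B (step_elt q f) = q.
Proof. by rewrite /step_elt; case: e. Qed.

Definition cyl (X : {set pts B}) (x : pts A) : {set pts W} :=
  match e return {set pts (mixed_step e A B)} with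
  | true => [set phi : {ffun pts B -> pts A} | [forall t in X, phi t == x]]
  | false => setX [set x] X
  end.

End MixedStep.

Definition transitive_on (B : permGroup) := forall w w', exists q, pact B w q = w'.

Section Cylinders.
Variables (A B : permGroup).

Lemma pact_exp_top (phi : {ffun pts B -> pts A}) q t :
  (pact (exponentiation A B) phi (step_top true A q) : {ffun _ -> _}) t
    = phi (pact B t q^-1).
Proof. by rewrite /= /exp_fun /= !ffunE act1. Qed.

Lemma pact_exp_bas (phi : {ffun pts B -> pts A}) f t :
  (pact (exponentiation A B) phi (@step_bas true A B f) : {ffun _ -> _}) t
    = pact A (phi t) (f t).
Proof. by rewrite /= /exp_fun /= !ffunE invg1 act1. Qed.

Lemma pact_pwr_top i t q :
  pact (permutational_wreath A B) (i, t) (step_top false A q) = (i, pact B t q).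
Proof. by rewrite /= /pwr_fun /= !ffunE act1. Qed.

Lemma pact_pwr_bas i t f :
  pact (permutational_wreath A B) (i, t) (@step_bas false A B f)
    = (pact A i (f t), t).
Proof. by rewrite /= /pwr_fun /= !act1. Qed.

Variables (e : bool) (X : {set pts B}).
Local Notation W := (mixed_step e A B).

Lemma cyl_top (x : pts A) q : preserves X q -> preserves (cyl e X x) (step_top e A q).
Proof.
move=> Xq; rewrite /cyl; case: e => [phi | [i t]]; last first.
  by rewrite pact_pwr_top !inE /= Xq.
rewrite !inE; apply/forall_inP/forall_inP => phix t Xt; have := phix.
  move/(_ (pact B t q)); rewrite Xq pact_exp_top actK; exact.
by rewrite pact_exp_top; apply; rewrite (preservesV Xq).
Qed.

Lemma cyl_loc x (u : grp A) (Z : {set pts B}) : (forall w, w \in Z -> w \notin X) ->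
  preserves (cyl e X x) (step_bas e (loc u Z)).
Proof.
move=> ZX; have uX t : t \in X -> loc u Z t = 1.
  by rewrite ffunE; case: ifP => // /ZX/negPf ->.
rewrite /cyl; case: e => [phi | [i t]]; last first.
  rewrite pact_pwr_bas !inE /=; case: (boolP (t \in X)) => [/uX -> | _].
    by rewrite act1.
  by rewrite !andbF.
rewrite !inE; apply/forall_inP/forall_inP => phix t Xt; have := phix t Xt.
  by rewrite pact_exp_bas uX ?act1.
by rewrite pact_exp_bas uX ?act1.
Qed.

Lemma cyl_loc_fixed (x : pts A) (u : grp A) : pact A x u = x ->
  preserves (cyl e X x) (step_bas e (loc u X)).
Proof.
move=> ux; have uV i : (pact A i u == x) = (i == x).
  by rewrite -{1}ux (inj_eq (act_inj _ _)).
rewrite /cyl; case: e => [phi | [i t]]; last first.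
  by rewrite pact_pwr_bas !inE /= ffunE; case: ifP; rewrite ?uV ?andbF.
rewrite !inE; apply: eq_forallb => t.
by rewrite pact_exp_bas ffunE; case: ifP; rewrite ?uV.
Qed.

Lemma cyl_loc_moved x0 (y : pts A) (u : grp A) : 
  x0 \in X -> pact A y u != y -> forall w, w \in cyl e X y ->
  pact W w (step_bas e (loc u X)) \notin cyl e X y.
Proof.
move=> Xx0 uy; rewrite /cyl; case: e => [phi | [i t]]; last first.
  by rewrite pact_pwr_bas !inE /= ffunE => /andP[/eqP -> ->]; rewrite (negPf uy).
rewrite !inE => /forall_inP/(_ _ Xx0)/eqP phi0; apply/forall_inP => /(_ _ Xx0).
by rewrite pact_exp_bas ffunE Xx0 phi0 (negPf uy).
Qed.

Lemma cyl_disjoint x0 (x y : pts A) : x0 \in X -> x != y ->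
  forall w, w \in cyl e X y -> w \notin cyl e X x.
Proof.
move=> Xx0 xy; rewrite /cyl; case: e => [phi | [i t]]; last first.
  by rewrite !inE /= => /andP[/eqP -> ->]; rewrite eq_sym (negPf xy).
rewrite !inE => /forall_inP/(_ _ Xx0)/eqP phi0; apply/forall_inP => /(_ _ Xx0).
by rewrite phi0 eq_sym (negPf xy).
Qed.

Lemma cyl_nonempty x0 (x : pts A) : x0 \in X -> exists w, w \in cyl e X x.
Proof.
move=> Xx0; rewrite /cyl; case: e; last by exists (x, x0); rewrite !inE eqxx.
exists ([ffun=> x] : {ffun pts B -> pts A}); rewrite inE.
by apply/forall_inP => t _; rewrite ffunE.
Qed.

Hypothesis Atr : transitive_on A.
Hypothesis Btr : transitive_on B.

Lemma transitive_ffun (phi phi' : pts B -> pts A) :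
  exists f : base_group A B, forall t, pact A (phi t) (f t) = phi' t.
Proof.
have [f fP] := fin_all_exists (fun t => Atr (phi t) (phi' t)).
by exists [ffun t => f t] => t; rewrite ffunE.
Qed.

Lemma mixed_step_transitive : transitive_on W.
Proof.
case: e => [phi phi' | [i t] [i' t']]; last first.
  have [q tq] := Btr t t'; have [u iu] := Atr i i'.
  exists (step_top false A q * step_bas false [ffun=> u]).
  by rewrite actM pact_pwr_top pact_pwr_bas tq ffunE iu.
have [f fP] := transitive_ffun (phi : {ffun _ -> _}) (phi' : {ffun _ -> _}).
by exists (step_bas true f); apply/ffunP => t; rewrite pact_exp_bas fP.
Qed.

(** In an exponentiation the action on functions is free enough to make the
    first function constant on X while the second one misses y at a point
    where the two differ.  In a permutational wreath product, two points above
    different points of B are sent to the first coordinates y and x. *)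
Lemma cyl_separating x0 (x y : pts A) : x0 \in X -> x != y -> separating (cyl e X y).
Proof.
move=> Xx0 xy; rewrite /cyl; case: e => [phi phi' | [i t] [i' t']]; last first.
  have [q tq] := Btr t x0; have [u iu] := Atr i y; have [v iv] := Atr i' x.
  exists (step_top false A q
          * step_bas false [ffun t => if t == x0 then u else v]).
  rewrite !actM !pact_pwr_top !pact_pwr_bas !inE !ffunE /= tq eqxx iu eqxx Xx0.
  split=> // nit; case: (eqVneq (pact B t' q) x0) => t'0; last by rewrite iv (negPf xy).
  have tt : t' = t by apply: (act_inj (pact B) q); rewrite /= tq.
  have ni : i' != i by apply: contra nit => /eqP ->; rewrite tt.
  by rewrite -iu (inj_eq (act_inj _ _)) (negPf ni).
have [t0 t0P] : exists t0, phi' != phi -> phi' t0 != phi t0.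
  case: (eqVneq phi' phi) => [_ | np]; first by exists x0.
  case: (pickP (fun t => phi' t != phi t)) => [t ? | eqp]; first by exists t.
  by case/eqP: np; apply/ffunP => t; apply/eqP/negPn; rewrite eqp.
have [q t0q] := Btr t0 x0.
pose psi := pact (exponentiation A B) phi (step_top true A q).
have [f fP] := transitive_ffun (psi : {ffun _ -> _}) (fun=> y).
exists (step_top true A q * step_bas true f); rewrite !actM !inE; split.
  by apply/forall_inP => t _; rewrite pact_exp_bas fP.
move=> /t0P n0; apply/forall_inP => /(_ _ Xx0).
rewrite pact_exp_bas -(fP x0) (inj_eq (act_inj _ _)) /psi !pact_exp_top.
by rewrite -t0q actK (negPf n0).
Qed.

End Cylinders.

(** * The second level *)

Lemma loc_set1 (A B : permGroup) (u : grp A) t (t' : pts B) :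
  loc u [set t] t' = if t' == t then u else 1.
Proof. by rewrite ffunE inE. Qed.

Section Seed.
Variables (A B : permGroup) (W : finGroupType).
Variables (top : grp B -> W) (bas : base_group A B -> W).
Hypothesis basM : {morph bas : x y / x * y}.
Hypothesis bas_top : forall f q, bas f ^ top q = bas (base_perm f q).
Hypothesis wreathE : forall w, exists q f, w = top q * bas f.
Hypothesis Aperf : [~: [set: grp A], [set: grp A]] = [set: grp A].
Variables (D : nat) (s : 'I_D.+1 -> grp A).
Hypothesis Agen : <<[set s i | i : 'I_D.+1]>> = [set: grp A].
Hypothesis Dgt0 : (0 < D)%N.
Hypothesis Btr : transitive_on B.
Variables (t : pts B) (q : grp B).
Hypothesis tqq : pact B (pact B t q) q != t.

(** The f_j: D elements whose entries at two points of B include all the D + 1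
    generators of A; s_0 is repeated so that it disappears from the
    commutators of two of them. *)
Definition seed (j : 'I_D) : base_group A B :=
  loc (s (lift ord0 j)) [set t] * loc (s ord0) [set pact B t q].

Let tq : pact B t q != t.
Proof. by apply: contra tqq => /eqP tq; rewrite !tq. Qed.

Lemma seed_t j : seed j t = s (lift ord0 j).
Proof. by rewrite ffunE !loc_set1 eqxx eq_sym (negPf tq) mulg1. Qed.

Lemma seed_tq j : seed j (pact B t q) = s ord0.
Proof. by rewrite ffunE !loc_set1 eqxx (negPf tq) mul1g. Qed.

Lemma seed_off j t' : t' != t -> t' != pact B t q -> seed j t' = 1.
Proof. by move=> n1 n2; rewrite ffunE !loc_set1 (negPf n1) (negPf n2) mulg1. Qed.

Lemma base_conjE (f g : base_group A B) t' : (f ^ g) t' = f t' ^ g t'.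
Proof. by rewrite !ffunE. Qed.

Lemma base_commE (f g : base_group A B) t' : [~ f, g] t' = [~ f t', g t'].
Proof. by rewrite !ffunE. Qed.

Lemma loc_conj (u : grp A) t' (f : base_group A B) :
  loc u [set t'] ^ f = loc (u ^ f t') [set t'].
Proof.
apply/ffunP => x; rewrite base_conjE !loc_set1.
by case: eqP => [-> //|_]; rewrite conj1g.
Qed.

Lemma shift_set1 t' p : shift [set t'] p = [set pact B t' p].
Proof.
apply/setP => w; rewrite !inE; apply/eqP/eqP => [<- | ->]; last by rewrite actK.
by rewrite actKV.
Qed.

(** The element q moves the second point of the seeds to a third one, so the
    conjugate by q of a seed meets another seed in one point only, with entries
    s_{j+1} and s_0.  With the commutators of two seeds this gives all the
    [s_i, s_j] at one point. *)
Lemma seed_full (K : {group W}) : (forall p, top p \in K) ->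
  (forall j, bas (seed j) \in K) -> forall w, w \in K.
Proof.
move=> topK seedK; apply: (wreath_full basM wreathE topK).
have moveK u t' p :
    (bas (loc u [set pact B t' p]) \in K) = (bas (loc u [set t']) \in K).
  by rewrite -shift_set1 -loc_shift -bas_top groupJr.
suff tK u : bas (loc u [set t]) \in K.
  by move=> t' u; have [p <-] := Btr t t'; rewrite moveK.
apply: (@perfect_absorb _ _ _ s (fun u => bas (loc u [set t]))) => // {u}.
- by move=> x y /=; rewrite locM basM.
- move=> i; case: (unliftP ord0 i) => [j -> | ->].
    exists (bas (seed j)) => // u.
    by rewrite -(morph_conj basM) loc_conj seed_t.
  pose j0 := Ordinal Dgt0.
  exists (bas (seed j0) ^ top q^-1) => [|u]; first by rewrite groupJ.
  have tE v : bas (loc v [set t]) = bas (loc v [set pact B t q]) ^ top q^-1.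
    by rewrite bas_top loc_shift shift_set1 actK.
  by rewrite !tE -conjJg -(morph_conj basM) loc_conj seed_tq.
have liftK j j' : bas (loc [~ s (lift ord0 j), s (lift ord0 j')] [set t]) \in K.
  suff -> : loc [~ s (lift ord0 j), s (lift ord0 j')] [set t] = [~ seed j, seed j'].
    by rewrite (morph_comm basM) groupR.
  apply/ffunP => x; rewrite base_commE loc_set1.
  case: (eqVneq x t) => [-> | xt]; first by rewrite !seed_t.
  case: (eqVneq x (pact B t q)) => [-> | xtq]; first by rewrite !seed_tq commgg.
  by rewrite !seed_off // commgg.
have lift0K j : bas (loc [~ s (lift ord0 j), s ord0] [set t]) \in K.
  rewrite -(moveK _ t q).
  suff -> : loc [~ s (lift ord0 j), s ord0] [set pact B t q]
      = [~ base_perm (seed j) q, seed j].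
    by rewrite (morph_comm basM) -bas_top groupR // groupJ.
  apply/ffunP => x; rewrite base_commE loc_set1 ffunE.
  case: (eqVneq x (pact B t q)) => [-> | xtq]; first by rewrite actK seed_t seed_tq.
  case: (eqVneq x t) => [-> | xt]; last by rewrite (seed_off _ xt xtq) commg1.
  rewrite (@seed_off _ (pact B t q^-1)) ?comm1g //.
    by apply: contra tq => /eqP tV; rewrite -{1}tV actKV.
  by apply: contra tqq => /eqP <-; rewrite actKV.
move=> i i'; case: (unliftP ord0 i) => [j -> | ->];
  case: (unliftP ord0 i') => [j' -> | ->] //.
  rewrite -invg_comm; set v := [~ _, _].
  by rewrite (morph_inv (locM [set t])) (morph_inv basM) groupV lift0K.
by rewrite commgg loc1 (morph_one basM) group1.
Qed.

End Seed.

(** * The factors *)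

Section PermGroupOf.
Variables (m : nat) (A : {group {perm 'I_m}}).
Local Notation P := (permGroup_of A).

Lemma permGroup_of_transitive :
  [transitive A, on [set: 'I_m] | 'P] -> transitive_on P.
Proof.
move=> Atr i j; have [g Ag ->] := atransP2 Atr (in_setT i) (in_setT j).
by exists (subg A g); rewrite /= /subg_perm /= subgK.
Qed.

Lemma subg_perfect : [~: A, A] = A -> [~: [set: grp P], [set: grp P]] = [set: grp P].
Proof.
move=> Aperf; have sgE : sgval @* [set: subg_of A] = A by exact: im_sgval.
apply: (injm_morphim_inj (injm_sgval A)); rewrite ?subsetT //.
by rewrite morphimR ?subsetT // sgE.
Qed.

Lemma subg_generators (D : nat) (Z : {set {perm 'I_m}}) :
  (#|Z| <= D)%N -> <<Z>> = A ->
  exists s : 'I_D -> grp P, <<[set s i | i : 'I_D]>> = [set: grp P].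
Proof.
move=> ZD genZ; exists (fun i : 'I_D => subg A (nth 1 (enum Z) i)).
apply/eqP; rewrite -subTset -im_subg.
have -> : subg A @* A = <<subg A @* Z>>.
  by rewrite -morphim_gen -?genZ ?subset_gen // genZ.
rewrite genS //; apply/subsetP => _ /morphimP[z Az Zz ->].
have zlt : (index z (enum Z) < D)%N.
  by apply: leq_trans ZD; rewrite cardE index_mem mem_enum.
apply/imsetP; exists (Ordinal zlt) => //=.
by rewrite nth_index ?mem_enum.
Qed.

Lemma stab_neq_fix_move (i j : 'I_m) : 'C_A[i | 'P] <> 'C_A[j | 'P] ->
  exists (x y : pts P) (a : grp P), [/\ x != y, pact P x a = x & pact P y a != y].
Proof.
move=> neq.
have fixm (x y : 'I_m) g : g \in 'C_A[x | 'P] -> g \notin 'C_A[y | 'P] ->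
    exists (x y : pts P) (a : grp P), [/\ x != y, pact P x a = x & pact P y a != y].
  move=> /setIP[Ag /astab1P xg]; rewrite inE Ag /= => ng.
  have yg : 'P%act y g != y by apply: contra ng => /eqP yg; apply/astab1P.
  exists x, y, (subg A g); rewrite /= /subg_perm /= subgK //; split=> //.
  by apply: contra yg => /eqP <-; apply/eqP.
case: (boolP ('C_A[i | 'P] \subset 'C_A[j | 'P])) => [sij | /subsetPn[g]];
  last exact: fixm.
case: (boolP ('C_A[j | 'P] \subset 'C_A[i | 'P])) => [sji | /subsetPn[g]];
  last exact: fixm.
by case: neq; apply/eqP; rewrite eqEsubset sij sji.
Qed.

Section NonAbelian.
Hypothesis Pperf : [~: [set: grp P], [set: grp P]] = [set: grp P].
Variables (y : pts P) (a : grp P).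
Hypothesis ya : pact P y a != y.

Lemma perfect_nonabelian : ~~ abelian [set: grp P].
Proof.
apply: contra ya => /commG1P; rewrite Pperf => P1.
have /set1P -> : a \in [1 grp P] by rewrite -P1 inE.
by rewrite act1.
Qed.

Lemma perfect_generators_gt1 (D : nat) (s : 'I_D -> grp P) :
  <<[set s i | i : 'I_D]>> = [set: grp P] -> (1 < D)%N.
Proof.
move=> gen; rewrite ltnNge; apply: contra perfect_nonabelian => D1.
rewrite -gen abelian_gen; apply/centsP => _ /imsetP[i _ ->] _ /imsetP[j _ ->].
suff -> : i = j by [].
by apply: val_inj; case: D D1 i j {s gen} => [|[|]] // _ [[|]] // ? [[|]].
Qed.

(** Otherwise the group has exponent 2, hence is abelian. *)
Lemma perfect_not_involutive : exists (t : pts P) (q : grp P),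
  pact P (pact P t q) q != t.
Proof.
case: (boolP [exists t : pts P, [exists q : grp P, pact P (pact P t q) q != t]]).
  by move/existsP => [t /existsP[q ?]]; exists t, q.
rewrite negb_exists => /forallP inv; case/negP: perfect_nonabelian.
have sqr q : q * q = 1 :> grp P.
  apply: val_inj; apply/permP => t; have := inv t.
  rewrite negb_exists => /forallP/(_ q)/negPn/eqP.
  by rewrite -actM /= /subg_perm => ->; rewrite perm1.
have invE q : q^-1 = q :> grp P by apply: (mulgI q); rewrite mulgV sqr.
by apply/centsP => g _ h _; rewrite /commute -[g * h]invE invMg !invE.
Qed.

End NonAbelian.

End PermGroupOf.

(** * The generators of the iterated wreath products *)

Section Tower.
Variables (mk : nat -> nat) (S : forall k, {group {perm 'I_(mk k)}}) (kk : nat -> nat).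
Local Notation P n := (permGroup_of (S n.+1)).
Local Notation G n := (mixed_wreath S kk n).
Local Notation e n := (in_kseq kk n.+2).

Hypothesis Ptr : forall n, transitive_on (P n).
Hypothesis Pperf : forall n, [~: [set: grp (P n)], [set: grp (P n)]] = [set: grp (P n)].
Variables (D : nat) (s : forall n, 'I_D.+1 -> grp (P n)).
Hypothesis Pgen : forall n, <<[set s n i | i : 'I_D.+1]>> = [set: grp (P n)].
Hypothesis Dgt0 : (0 < D)%N.
Variables (x y : forall n, pts (P n)) (a : forall n, grp (P n)).
Hypothesis xy : forall n, x n != y n.
Hypothesis xa : forall n, pact (P n) (x n) (a n) = x n.
Hypothesis ya : forall n, pact (P n) (y n) (a n) != y n.
Variables (t : pts (P 0)) (q : grp (P 0)).
Hypothesis tqq : pact (P 0) (pact (P 0) t q) q != t.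

Fixpoint tower_anchor n : {set pts (G n)} :=
  match n with
  | 0 => [set: pts (P 0)]
  | n'.+1 => cyl (e n') (tower_anchor n') (x n'.+1)
  end.

Definition tower_support n : {set pts (G n)} :=
  match n with
  | 0 => set0
  | n'.+1 => cyl (e n') (tower_anchor n') (y n'.+1)
  end.

Fixpoint tower_gen (i : 'I_D.+1) n : grp (G n) :=
  match n with
  | 0 => s 0 i
  | n'.+1 => step_top (e n') (P n'.+1) (tower_gen i n')
           * step_bas (e n') (loc (s n'.+1 i) (tower_support n'))
  end.

Fixpoint tower_shifter n : grp (G n) :=
  match n with
  | 0 => 1
  | n'.+1 => step_top (e n') (P n'.+1) (tower_shifter n')
           * step_bas (e n') (loc (a n'.+1) (tower_anchor n'))
  end.

Fixpoint tower_seed (j : 'I_D) n : grp (G n) :=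
  match n with
  | 0 => 1
  | n'.+1 => match n' return grp (G n') -> grp (G n'.+1) with
             | 0 => fun _ => step_bas (e 0) (@seed (P 1) (P 0) D (s 1) t q j)
             | n''.+1 => @step_top (e n''.+1) (P n''.+2) (G n''.+1)
             end (tower_seed j n')
  end.

Lemma tower_transitive n : transitive_on (G n).
Proof. by elim: n => [|n IHn]; [exact: Ptr | exact: mixed_step_transitive]. Qed.

Lemma tower_anchor_nonempty n : exists w, w \in tower_anchor n.
Proof.
elim: n => [|n [w Xw]]; first by exists t; rewrite inE.
exact: cyl_nonempty Xw.
Qed.

Lemma tower_disjoint n w : w \in tower_support n -> w \notin tower_anchor n.
Proof.
case: n w => [|n] w; first by rewrite inE.
by have [w0 Xw0] := tower_anchor_nonempty n; apply: cyl_disjoint Xw0 _ _.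
Qed.

Lemma tower_absorbs n : absorbs (tower_anchor n) (tower_support n)
  (tower_gen^~ n) (tower_shifter n) (tower_seed^~ n).
Proof.
elim: n => [|n IHn]; first exact: (absorbs_bottom (Pperf 0) (Pgen 0)).
have [w0 Xw0] := tower_anchor_nonempty n.
have tM := @step_topM (e n) (P n.+1) (G n).
have bM := @step_basM (e n) (P n.+1) (G n).
have bt := @step_bas_top (e n) (P n.+1) (G n).
have wE := @step_wreathE (e n) (P n.+1) (G n).
have tXY p : preserves (tower_anchor n) p ->
    preserves (tower_anchor n.+1) (step_top (e n) (P n.+1) p)
    /\ preserves (tower_support n.+1) (step_top (e n) (P n.+1) p).
  by split; apply: cyl_top.
have lXY (u : grp (P n.+1)) (Z : {set pts (G n)}) :
    (forall w, w \in Z -> w \notin tower_anchor n) ->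
    preserves (tower_anchor n.+1) (step_bas (e n) (loc u Z))
    /\ preserves (tower_support n.+1) (step_bas (e n) (loc u Z)).
  by split; apply: cyl_loc.
have aX := @cyl_loc_fixed (P n.+1) (G n) (e n) (tower_anchor n) _ _ (xa n.+1).
have aY := @cyl_loc_moved (P n.+1) (G n) (e n) (tower_anchor n) _ _ _ Xw0 (ya n.+1).
case: n IHn w0 Xw0 tM bM bt wE tXY lXY aX aY
    => [|n] IHn w0 Xw0 tM bM bt wE tXY lXY aX aY.
  apply: (absorbs_seed tM bM bt (@tower_disjoint 0) tXY lXY aX aY IHn) => // K tK fK.
  by apply: (seed_full bM bt wE _ _ _ _ tqq tK fK) => //; exact: tower_transitive.
apply: (absorbs_step tM bM bt wE (@tower_disjoint n.+1) tXY lXY aX aY _ _ IHn) => //.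
have [w1 Xw1] := tower_anchor_nonempty n.
by apply: cyl_separating Xw1 _ => //; exact: tower_transitive.
Qed.

Lemma tower_generated n (H : {group grp (G n)}) : (forall i, tower_gen i n \in H) ->
  tower_shifter n \in H -> (forall j, tower_seed j n \in H) -> forall g, g \in H.
Proof.
move=> bH cH fH g.
apply: (@tower_absorbs n _ id (fun=> 1) 1 H) => //=.
- by move=> p _; exact: commute1.
- by move=> p i _ _; exact: commute1.
- by move=> p i j _ _; rewrite conj1g.
- by move=> i; rewrite mulg1.
- by rewrite mulg1.
Qed.

Lemma tower_gen_compat i n : mixed_proj S kk n (tower_gen i n.+1) = tower_gen i n.
Proof. by rewrite /= step_eltM mixed_step_projE mulg1. Qed.

Lemma tower_shifter_compat n : mixed_proj S kk n (tower_shifter n.+1) = tower_shifter n.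
Proof. by rewrite /= step_eltM mixed_step_projE mulg1. Qed.

Lemma tower_seed_compat j n : mixed_proj S kk n (tower_seed j n.+1) = tower_seed j n.
Proof. by case: n => [|n]; rewrite /= mixed_step_projE. Qed.

End Tower.

Theorem theoremB (d m : int) (mk : nat -> nat)
    (S : forall k : nat, {group {perm 'I_(mk k)}}) (kk : nat -> nat)
    (S_trans : forall k, (0 < k)%N ->
       [transitive S k, on [set: 'I_(mk k)] | 'P])
    (S_perfect : forall k, (0 < k)%N -> [~: S k, S k] = S k)
    (S_gen : forall k, (0 < k)%N -> at_most_generated (S k) d)
    (S_stab : forall k, (0 < k)%N -> exists i j : 'I_(mk k),
       'C_(S k)[i | 'P] <> 'C_(S k)[j | 'P])
    (kk_gt0 : forall n, (0 < n)%N -> (0 < kk n)%N)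
    (kk_incr : forall n, (0 < n)%N -> (kk n < kk n.+1)%N)
    (kk_stride : stride_at_most kk m) :
  topologically_finitely_generated (mixed_wreath_limit S kk) /\
  topologically_at_most_generated (mixed_wreath_limit S kk) (2 * m * d)%R.
Proof.
pose P n := permGroup_of (S n.+1).
have Ptr n : transitive_on (P n) by apply/permGroup_of_transitive/S_trans.
have Pperf n : [~: [set: grp (P n)], [set: grp (P n)]] = [set: grp (P n)].
  by apply/subg_perfect/S_perfect.
have Pstab n : exists z : pts (P n) * pts (P n) * grp (P n),
    [/\ z.1.1 != z.1.2, pact (P n) z.1.1 z.2 = z.1.1
      & pact (P n) z.1.2 z.2 != z.1.2].
  have [i [j /stab_neq_fix_move[x [y [a ?]]]]] := S_stab n.+1 isT.
  by exists (x, y, a).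
pose z n := projT1 (boolp.cid (Pstab n)).
have zP n : [/\ (z n).1.1 != (z n).1.2, pact (P n) (z n).1.1 (z n).2 = (z n).1.1
    & pact (P n) (z n).1.2 (z n).2 != (z n).1.2] := projT2 (boolp.cid (Pstab n)).
have d_ge0 : (0 <= d)%R.
  by have [Z Zd _] := S_gen 1%N isT; apply: Order.POrderTheory.le_trans Zd.
case: d d_ge0 S_gen => // D _ S_gen.
have Pgen n : exists s : 'I_D -> grp (P n),
    <<[set s i | i : 'I_D]>> = [set: grp (P n)].
  by have [Z ZD genZ] := S_gen n.+1 isT; apply: subg_generators genZ.
have D1 : (1 < D)%N.
  have [_ _ ya] := zP 0; have [s sgen] := Pgen 0.
  exact: perfect_generators_gt1 (Pperf 0) _ _ ya _ _ sgen.
case: D D1 S_gen Pgen => // D D1 S_gen Pgen.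
pose s n := projT1 (boolp.cid (Pgen n)).
have sP n : <<[set s n i | i : 'I_D.+1]>> = [set: grp (P n)] :=
  projT2 (boolp.cid (Pgen n)).
have [t [q tqq]] : exists (t : pts (P 0)) (q : grp (P 0)),
    pact (P 0) (pact (P 0) t q) q != t.
  by have [_ _ ya] := zP 0; apply: perfect_not_involutive (Pperf 0) _ _ ya.
pose x n := (z n).1.1; pose y n := (z n).1.2; pose a n := (z n).2.
have xy n : x n != y n by case: (zP n).
have xa n : pact (P n) (x n) (a n) = x n by case: (zP n).
have ya n : pact (P n) (y n) (a n) != y n by case: (zP n).
pose bL i := Invlim (tower_gen_compat kk s x y i).
pose cL := Invlim (tower_shifter_compat kk x a).
pose fL j := Invlim (tower_seed_compat kk s t q j).
pose X := codom bL ++ cL :: codom fL.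
apply: (@finitely_generated_coords _ _ X) => [n H HX|].
  apply: (tower_generated Ptr Pperf sP D1 xy xa ya tqq).
  - by move=> i; apply: (HX (bL i)); rewrite mem_cat codom_f.
  - by apply: (HX cL); rewrite mem_cat in_cons eqxx orbT.
  - by move=> j; apply: (HX (fL j)); rewrite mem_cat in_cons codom_f !orbT.
rewrite size_cat /= !size_codom !card_ord.
have m1 : (1 <= m)%R.
  by have := kk_stride 1%N isT; have := kk_incr 1%N isT; lia.
have md : (D.+1%:Z <= m * D.+1%:Z)%R by rewrite Num.Theory.ler_peMl.
by rewrite -GRing.mulrA; move: (m * _)%R md => md; lia.
Qed.
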